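(* Let $n_1,\ldots,n_k$ be positive integers and let $\sigma$ be a permutation of $\{1,\ldots,k\}$. Then $$[U_{n_1\otimes n_2\otimes\cdots\otimes n_k}(\sigma)]=\left(U^{i_1i_2\ldots i_k}_{j_1j_2\ldots j_k}\right)=\left(\delta^{i_1}_{j_{\sigma(1)}}\delta^{i_2}_{j_{\sigma(2)}}\cdots\delta^{i_k}_{j_{\sigma(k)}}\right),$$ where $i_1i_2\ldots i_k$ are the row indices, with $1\le i_r\le n_{\sigma(r)}$, and $j_1j_2\ldots j_k$ are the column indices, with $1\le j_r\le n_r$, for $r=1,\ldots,k$.
   Context: $[U_{n_1\otimes\cdots\otimes n_k}(\sigma)]$ denotes the $\sigma$-tensor permutation matrix $n_1\otimes\cdots\otimes n_k$ with entries $0$ and $1$: the $n_1\cdots n_k\times n_1\cdots n_k$ matrix such that $[U_{n_1\otimes\cdots\otimes n_k}(\sigma)]\cdot([a_1]\otimes\cdots\otimes[a_k])=[a_{\sigma(1)}]\otimes\cdots\otimes[a_{\sigma(k)}]$ for all $[a_r]\in\mathcal{M}_{n_r\times 1}(\mathbb{K})$, $r=1,\ldots,k$. Here $\mathbb{K}=\mathbb{R}$ or $\mathbb{C}$ and $\otimes$ is the Kronecker product of matrices (the $(i,j)$ block of $[A]\otimes[B]$ is $A^i_j[B]$). $\delta^i_j$ is the Kronecker symbol. Rows and columns are labelled by multi-indices in lexicographic order (last index varying fastest): row $i_1\ldots i_k$ is the row numbered $n_{\sigma(k)}\cdots n_{\sigma(2)}(i_1-1)+n_{\sigma(k)}\cdots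 n_{\sigma(3)}(i_2-1)+\cdots+n_{\sigma(k)}(i_{k-1}-1)+i_k$, and column $j_1\ldots j_k$ is the column numbered $n_k\cdots n_2(j_1-1)+n_k\cdots n_3(j_2-1)+\cdots+n_k(j_{k-1}-1)+j_k$. *)

(* Defs.v *)
From mathcomp Require Import all_boot all_order all_fingroup all_algebra.
From mathcomp Require Import mxtens.

Set Implicit Arguments.
Unset Strict Implicit.
Unset Printing Implicit Defensive.

Import GRing.Theory.
Local Open Scope ring_scope.

(* All indices are 0-based: 'I_k stands for {1, ..., k} and 'I_(n r) for
   {1, ..., n_r}. The Kronecker product of two matrices is tensmx. *)

Definition kron_dim k (n : 'I_k -> nat) : nat := (\prod_(r < k) n r)%N.

Lemma kron_dim_recl k (n : 'I_k.+1 -> nat) :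
  kron_dim n = (n ord0 * kron_dim (fun r => n (lift ord0 r)))%N.
Proof. exact: big_ord_recl. Qed.

Lemma kron_dim_perm k (n : 'I_k -> nat) (s : 'S_k) :
  kron_dim (fun r => n (s r)) = kron_dim n.
Proof. by rewrite /kron_dim [RHS](reindex_inj (@perm_inj _ s)). Qed.

(* The column vector a_1 (x) (a_2 (x) ... (x) (a_k (x) 1)). *)
Fixpoint kron_col (K : pzRingType) k :
    forall n : 'I_k -> nat, (forall r, 'cV[K]_(n r)) -> 'cV[K]_(kron_dim n) :=
  match k return forall n : 'I_k -> nat,
      (forall r, 'cV[K]_(n r)) -> 'cV[K]_(kron_dim n) with
  | 0 => fun n _ => const_mx 1
  | k'.+1 => fun n a =>
      castmx (esym (kron_dim_recl n), muln1 1)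
        (tensmx (a ord0) (kron_col (fun r => a (lift ord0 r))))
  end.

Lemma lex_index_subproof k (n : 'I_k -> nat) (i : forall r, 'I_(n r)) :
  (\sum_(r < k) i r * \prod_(t < k | (r < t)%N) n t < kron_dim n)%N.
Proof.
elim: k n i => [|k IHk] n i; first by rewrite /kron_dim !big_ord0.
have tail (r0 : nat) : (\prod_(t < k.+1 | (r0 < t)%N) n t =
    (if (r0 < 0)%N then n ord0 else 1)
    * \prod_(t < k | (r0 < t.+1)%N) n (lift ord0 t))%N.
  by rewrite big_mkcond big_ord_recl /= -big_mkcond.
rewrite kron_dim_recl big_ord_recl tail /= mul1n.
under [X in (_ + X)%N]eq_bigr => r _ do rewrite tail /= mul1n.
have := IHk _ (fun r => i (lift ord0 r)).
rewrite -/(kron_dim (fun r => n (lift ord0 r))) => lt_tail.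
apply: leq_trans (leq_mul (ltn_ord (i ord0)) (leqnn _)).
by rewrite mulSn addnC ltn_add2r.
Qed.

(* The position of the multi-index i_1 ... i_k in lexicographic order, the last
   index varying fastest: the sum over r of i_r * n_{r+1} * ... * n_k. *)
Definition lex_index k (n : 'I_k -> nat) (i : forall r, 'I_(n r)) :
    'I_(kron_dim n) :=
  Ordinal (lex_index_subproof i).

(* The bounds of a row multi-index are n_{s 1}, ..., n_{s k}, those of a column
   multi-index are n_1, ..., n_k. *)
Definition row_index k (n : 'I_k -> nat) (s : 'S_k)
    (i : forall r, 'I_(n (s r))) : 'I_(kron_dim n) :=
  cast_ord (kron_dim_perm n s) (lex_index i).

Definition col_index k (n : 'I_k -> nat) (j : forall r, 'I_(n r)) :
    'I_(kron_dim n) :=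
  lex_index j.

(* U . (a_1 (x) ... (x) a_k) = a_{s 1} (x) ... (x) a_{s k} for all a. *)
Definition is_tensor_permutation (K : pzRingType) k (n : 'I_k -> nat) (s : 'S_k)
    (U : 'M[K]_(kron_dim n)) : Prop :=
  forall a : forall r, 'cV[K]_(n r),
    U *m kron_col a
    = castmx (kron_dim_perm n s, erefl 1%N) (kron_col (fun r => a (s r))).
Arguments is_tensor_permutation {K k} n s U.

(* Main.v *)
Require Import Defs.
From mathcomp Require Import all_boot all_order all_fingroup all_algebra.
From mathcomp Require Import mxtens.

(** Lexicographic numbering is a bijection between the multi-indices bounded by
    [n_1, ..., n_k] and the indices of a matrix of size [n_1 * ... * n_k]
    ([lex_index_inj], [lex_index_surj]), and the Kronecker product of columns
    has entry [a_1(j_1) * ... * a_k(j_k)] at the position of [j_1 ... j_k]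
    ([kron_colE]).

    Consequently the columns [e_(j_1) (x) ... (x) e_(j_k)] are exactly the
    vectors of the standard basis ([kron_col_delta]), so that a matrix is
    determined by its action on Kronecker products ([kron_col_ext]): this is
    uniqueness.

    For existence, [a_(s 1) (x) ... (x) a_(s k)] has at [j_(s 1) ... j_(s k)]
    the entry that [a_1 (x) ... (x) a_k] has at [j_1 ... j_k], the factors being
    merely reordered. Hence the matrix of the permutation of positions
    [j_1 ... j_k |-> j_(s 1) ... j_(s k)] has the required action, and its entry
    in row [i] and column [j] is 1 exactly when [i_r = j_(s r)] for all [r]. *)

Set Implicit Arguments.
Unset Strict Implicit.
Unset Printing Implicit Defensive.

Import GRing.Theory.
Local Open Scope ring_scope.

Lemma prod_indicator (R : comPzRingType) (I : finType) (P : pred I) :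
  \prod_r (P r)%:R = [forall r, P r]%:R :> R.
Proof.
case: forallP => [allP | nallP]; first by rewrite big1 // => r _; rewrite allP.
have /existsP[r /negPf PrF] : [exists r, ~~ P r].
  by rewrite -negb_forall; apply/forallP.
by rewrite (bigD1 r) //= PrF mul0r.
Qed.

Lemma eq_lex_index k (n : 'I_k -> nat) (i j : forall r, 'I_(n r)) :
  (forall r, i r = j r) -> lex_index i = lex_index j.
Proof. by move=> eq_ij; apply/val_inj/eq_bigr => r _; rewrite eq_ij. Qed.

(** The leading digit of a mixed radix numeral, split off with the index pairing of
    [tensmx], so that inductions on [k] match the recursion of [kron_col]. *)
Lemma lex_index_recl k (n : 'I_k.+1 -> nat) (i : forall r, 'I_(n r)) :
  lex_index i = cast_ord (esym (kron_dim_recl n))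
    (mxtens_index (i ord0, lex_index (fun r => i (lift ord0 r)))).
Proof.
apply: val_inj; rewrite /= big_ord_recl /=; congr (_ * _ + _)%N.
  by rewrite big_mkcond big_ord_recl /= mul1n.
apply: eq_bigr => r _; congr (_ * _)%N.
by rewrite big_mkcond big_ord_recl /= mul1n -big_mkcond.
Qed.

Lemma lex_index_inj k (n : 'I_k -> nat) (i j : forall r, 'I_(n r)) :
  lex_index i = lex_index j -> forall r, i r = j r.
Proof.
elim: k n i j => [|k IHk] n i j; first by move=> _ [].
rewrite !lex_index_recl => /cast_ord_inj/(can_inj (@mxtens_indexK _ _)) eq_ij r.
case: (unliftP ord0 r) => [r' ->|->]; last exact: (congr1 fst eq_ij).
exact: IHk (congr1 snd eq_ij) r'.
Qed.

(** There are as many multi-indices as positions, so injectivity suffices. *)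
Lemma lex_index_surj k (n : 'I_k -> nat) :
  exists g : 'I_(kron_dim n) -> forall r, 'I_(n r), cancel g (@lex_index k n).
Proof.
pose f (i : {dffun forall r, 'I_(n r)}) := lex_index i.
have f_inj : injective f by move=> i j /lex_index_inj eq_ij; apply/ffunP.
have [|g _ gK] := inj_card_bij f_inj; last by exists (fun x r => g x r).
rewrite card_ord card_dep_ffun foldrE big_map big_enum /=.
by rewrite /kron_dim; under [leqRHS]eq_bigr do rewrite card_ord.
Qed.

Lemma row_index_inj k (n : 'I_k -> nat) (s : 'S_k)
    (i j : forall r, 'I_(n (s r))) :
  row_index i = row_index j -> forall r, i r = j r.
Proof. by move=> /cast_ord_inj/lex_index_inj. Qed.

Lemma kron_colE (K : pzRingType) k (n : 'I_k -> nat)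
    (a : forall r, 'cV[K]_(n r)) (j : forall r, 'I_(n r)) :
  kron_col a (lex_index j) 0 = \prod_r a r (j r) 0.
Proof.
elim: k n a j => [|k IHk] n a j; first by rewrite mxE big_ord0.
rewrite big_ord_recl -IHk lex_index_recl /= castmxE cast_ordK.
by rewrite mxE mxtens_indexK /= !ord1.
Qed.

Lemma kron_col_delta (K : comPzRingType) k (n : 'I_k -> nat)
    (j : forall r, 'I_(n r)) :
  kron_col (fun r => delta_mx (j r) 0 : 'cV[K]_(n r)) = delta_mx (lex_index j) 0.
Proof.
have [g gK] := lex_index_surj n.
apply/colP=> x; rewrite -[x]gK kron_colE mxE eqxx andbT.
under eq_bigr do rewrite mxE eqxx andbT.
rewrite prod_indicator; congr (_ : bool)%:R.
apply/forallP/eqP => [eq_xj | /lex_index_inj eq_xj r]; last exact/eqP/eq_xj.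
by apply: eq_lex_index => r; apply/eqP.
Qed.

(** Every standard basis vector is a Kronecker product of basis vectors, and
    these products extract the columns of [U] and [V] one by one. *)
Lemma kron_col_ext (K : comPzRingType) k (n : 'I_k -> nat) m
    (U V : 'M[K]_(m, kron_dim n)) :
  (forall a : forall r, 'cV[K]_(n r), U *m kron_col a = V *m kron_col a) ->
  U = V.
Proof.
move=> eqUV; have [g gK] := lex_index_surj n.
apply/matrixP=> x y; have := eqUV (fun r => delta_mx (g y r) 0).
by rewrite kron_col_delta gK -!colE => /colP/(_ x); rewrite !mxE.
Qed.

(** Both sides are the same product, with factors indexed by [s r] on the left
    and by [r] on the right. *)
Lemma kron_col_perm (K : comPzRingType) k (n : 'I_k -> nat) (s : 'S_k)
    (a : forall r, 'cV[K]_(n r)) (j : forall r, 'I_(n r)) :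
  castmx (kron_dim_perm n s, erefl 1%N) (kron_col (fun r => a (s r)))
    (row_index (fun r => j (s r))) 0 = kron_col a (lex_index j) 0.
Proof.
rewrite castmxE cast_ordK cast_ord_id !kron_colE.
by rewrite [RHS](reindex_inj (@perm_inj _ s)).
Qed.

Theorem proposition0p6p2 (K : numFieldType) (k : nat) (hk : (0 < k)%N)
    (n : 'I_k -> nat) (hn : forall r : 'I_k, (0 < n r)%N) (s : 'S_k) :
  exists2 U : 'M[K]_(kron_dim n),
    unique (is_tensor_permutation n s) U
    & forall (i : forall r : 'I_k, 'I_(n (s r))) (j : forall r : 'I_k, 'I_(n r)),
        U (row_index i) (col_index j) = \prod_(r < k) (i r == j (s r))%:R.
Proof.
have [g gK] := lex_index_surj n.
(* [f] sends the position of [j] to that of [j \o s], among the row indices. *)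
pose f y : 'I_(kron_dim n) := row_index (fun r => g y (s r)).
have f_inj : injective f.
  move=> x y /row_index_inj eq_xy; rewrite -[x]gK -[y]gK.
  (* Every [r] is [s r'] for [r' = s^-1 r], so no coordinate is lost. *)
  by apply: eq_lex_index => r; rewrite -[r](permKV s).
pose U : 'M[K]_(kron_dim n) := \matrix_(x, y) (x == f y)%:R.
have Utens : is_tensor_permutation n s U.
  move=> a; apply/colP=> x; have [h _ hK] := injF_bij f_inj.
  rewrite -[x]hK kron_col_perm gK mxE (bigD1 (h x)) //= mxE eqxx mul1r.
  rewrite big1 ?addr0 // => y /negPf neq_y.
  by rewrite mxE (inj_eq f_inj) eq_sym neq_y mul0r.
exists U => [|i j].
  by split=> // V Vtens; apply: kron_col_ext => a; rewrite Utens Vtens.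
have gj r : g (lex_index j) r = j r by apply: lex_index_inj; rewrite gK.
rewrite mxE prod_indicator; congr (_ : bool)%:R.
apply/eqP/forallP => [/row_index_inj eq_ij r | eq_ij].
  by rewrite eq_ij gj.
by congr cast_ord; apply: eq_lex_index => r; rewrite gj; apply/eqP.
Qed.
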